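(* Let $\Lambda$ be a commutative Noetherian ring in which linear equations are solvable, $I=\langle\nu_1,\ldots,\nu_s\rangle$ a proper ideal of $\Lambda$, $R=\Lambda/I$, $T=\Lambda[x_1,\ldots,x_n,y_1,\ldots,y_m]$, $A=R[x_1,\ldots,x_n,y_1,\ldots,y_m]$, and $\varphi:T\to A$ the canonical ring epimorphism reducing coefficients modulo $I$. Let $\overline J=\langle\overline f_1,\ldots,\overline f_t\rangle$ be an ideal of $A$ with $\overline f_i\neq0$, let $f_i\in T$ be obtained from $\overline f_i$ by replacing each nonzero coefficient by a representative in $\Lambda$, let $S=\{f_1,\ldots,f_t,\nu_1,\ldots,\nu_s\}$ and $J=\langle S\rangle\subseteq T$. Let $\prec$ be an elimination ordering on the monomials of $T$ with the $y$ variables larger than the $x$ variables, let $\mathcal G$ be a Gröbner basis of $J$ with respect to $\prec$ constructed by the Gröbner basis algorithm (recalled in the context) with initial input $S$, and let $\overline{\mathcal G}=\varphi(\mathcal G)-\{0\}$. Then $\overline{\mathcal G}\cap R[x_1,\ldots,x_n]$ is a Gröbner basis for $\overline J\cap R[x_1,\ldots,x_n]$ with respect to the restriction of $\prec$ to the monomials in $x_1,\ldots,x_n$.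
   Context: Linear equations are solvable in $\Lambda$ if there are algorithms (1) deciding, for $\lambda,\lambda_1,\ldots,\lambda_k\in\Lambda$, whether $\lambda\in\langle\lambda_1,\ldots,\lambda_k\rangle$ and in that case computing $\mu_i$ with $\lambda=\sum\lambda_i\mu_i$, and (2) computing generators of the syzygy module $\{(\mu_i)\in\Lambda^k\mid\sum\lambda_i\mu_i=0\}$. An elimination ordering with the $y$ variables larger than the $x$ variables is a monomial ordering with $x^\alpha y^\beta\prec x^{\alpha'}y^{\beta'}$ iff $y^\beta\prec y^{\beta'}$, or $y^\beta=y^{\beta'}$ and $x^\alpha\prec x^{\alpha'}$. For a nonzero polynomial $f$ written with nonzero coefficients, $\mathbf{LM}(f)$ is its $\prec$-largest monomial, $\mathbf{LC}(f)$ the corresponding coefficient, $\mathbf{LT}(f)=\mathbf{LC}(f)\mathbf{LM}(f)$. A finite set $\mathcal G$ of nonzero elements of an ideal $J$ of a polynomial ring over a commutative Noetherian ring is a Gröbner basis of $J$ if $\langle\mathbf{LT}(J)\rangle=\langle\mathbf{LT}(\mathcal G)\rangle$. Reduction: $f\ne0$ reduces in one step modulo a finite set $F$ of nonzero polynomials to $f-\sum_j\lambda_ju_jf_{i_j}$ if $f_{i_j}\in F$, $\lambda_j\in\Lambda-\{0\}$, $u_j$ are monomials, $\mathbf{LM}(f)=u_j\mathbf{LM}(f_{i_j})$ for all $j$, and $\mathbf{LT}(f)=\sum_j\lambda_ju_j\mathbf{LT}(f_{i_j})$; $f\ne 0$ is minimal with respect to $F$ if no such step exists. Gröbner basis algorithm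 with input a finite set $S$ of nonzero polynomials (zero elements discarded): start with $G:=\emptyset$, $G':=S$. While $G'\ne G$: set $G:=G'=\{g_1,\ldots,g_k\}$; compute a finite homogeneous generating set $B$ of $\mathrm{Syz}_T(\mathbf{LT}(g_1),\ldots,\mathbf{LT}(g_k))$; for each $(h_1,\ldots,h_k)\in B$ reduce $\sum h_ig_i$ modulo the current $G'$ to some $r$ that is $0$ or minimal with respect to $G'$, and if $r\neq0$ replace $G'$ by $G'\cup\{r\}$. The output is $G$, a Gröbner basis of $\langle S\rangle$. *)

(* Defs.v *)
From HB Require Import structures.
From mathcomp Require Import all_boot all_order all_algebra.
From mathcomp Require Import finmap mpoly.

Set Implicit Arguments.
Unset Strict Implicit.
Unset Printing Implicit Defensive.

Import GRing.Theory.
Local Open Scope ring_scope.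

(* Ideals and submodules are Prop-valued predicates: membership in them is not
   assumed to be decidable. *)

Definition ideal_span (R : comNzRingType) (X : R -> Prop) (a : R) : Prop :=
  exists2 s : seq (R * R),
    {in s, forall q, X q.2} & a = \sum_(q <- s) q.1 * q.2.

Definition is_ideal (R : comNzRingType) (J : R -> Prop) : Prop :=
  [/\ J 0,
      (forall a b, J a -> J b -> J (a + b)) &
      (forall c a, J a -> J (c * a))].

Definition module_span (R : nzRingType) (V : lmodType R) (X : V -> Prop)
    (v : V) : Prop :=
  exists2 s : seq (R * V),
    {in s, forall q, X q.2} & v = \sum_(q <- s) q.1 *: q.2.

Definition module_generates (R : nzRingType) (V : lmodType R)
    (B : seq V) (M : V -> Prop) : Prop :=
  forall v, M v <-> module_span (fun b => b \in B) v.

Definition noetherian (R : comNzRingType) : Prop :=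
  forall J : R -> Prop, is_ideal J ->
    exists s : seq R, forall a, J a <-> ideal_span (fun b => b \in s) a.

Definition syzygy (R : comNzRingType) (k : nat) (a : 'I_k -> R)
    (h : 'rV[R]_k) : Prop :=
  \sum_(i < k) a i * h 0 i = 0.

(* Solvability of linear equations as data: algorithms are rendered by the
   functions lin_solve and lin_syz, which need not be computable. *)
Record linear_solver (L : comNzRingType) : Type := LinearSolver {
  lin_solve : forall k : nat, L -> ('I_k -> L) -> option 'rV[L]_k;
  lin_solveP : forall (k : nat) (b : L) (a : 'I_k -> L),
    if lin_solve b a is Some mu then b = \sum_(i < k) a i * mu 0 i
    else ~ ideal_span (fun c => exists i, c = a i) b;
  lin_syz : forall k : nat, ('I_k -> L) -> seq 'rV[L]_k;
  lin_syzP : forall (k : nat) (a : 'I_k -> L),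
    module_generates (lin_syz a) (syzygy a)
}.

(* Monomial orderings are given by their strict part. *)
Definition monomial_order (k : nat) (lt : rel 'X_{1..k}) : Prop :=
  [/\ irreflexive lt,
      transitive lt,
      (forall a b, a != b -> lt a b || lt b a),
      (forall a b c, lt a b -> lt (a + c)%MM (b + c)%MM) &
      well_founded lt].

(* The first n of the n + m variables are the x's, the last m are the y's:
   mon_xy a b is x^a y^b. *)
Definition mon_xy (n m : nat) (a : 'X_{1..n}) (b : 'X_{1..m}) : 'X_{1..n + m} :=
  [multinom match split i with inl j => a j | inr j => b j end | i < n + m].

Definition elimination_order (n m : nat) (lt : rel 'X_{1..n + m}) : Prop :=
  monomial_order lt /\
  forall (a a' : 'X_{1..n}) (b b' : 'X_{1..m}),
    lt (mon_xy a b) (mon_xy a' b') <->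
    lt (mon_xy 0%MM b) (mon_xy 0%MM b') \/
    b = b' /\ lt (mon_xy a 0%MM) (mon_xy a' 0%MM).

Definition restrict_x (n m : nat) (lt : rel 'X_{1..n + m}) : rel 'X_{1..n} :=
  fun a a' => lt (mon_xy a 0%MM) (mon_xy a' 0%MM).

Definition embed_x (R : comNzRingType) (n m : nat) (p : {mpoly R[n]}) :
    {mpoly R[n + m]} :=
  p \mPo [tuple 'X_(lshift m i) | i < n].

Section LeadingTerms.
Variables (R : comNzRingType) (k : nat) (lt : rel 'X_{1..k}).
Local Notation T := {mpoly R[k]}.

(* Junk value 0%MM when f = 0. *)
Definition LM (f : T) : 'X_{1..k} :=
  head 0%MM [seq u <- msupp f | all (fun v => (v == u) || lt v u) (msupp f)].
Definition LC (f : T) : R := f@_(LM f).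
Definition LT (f : T) : T := LC f *: 'X_[LM f].

Definition LT_set (X : T -> Prop) (p : T) : Prop :=
  exists f, [/\ X f, f <> 0 & p = LT f].

Definition is_groebner_basis (J G : T -> Prop) : Prop :=
  [/\ (exists s : seq T, forall g, G g <-> g \in s),
      (forall g, G g -> J g /\ g <> 0) &
      (forall p, ideal_span (LT_set J) p <-> ideal_span (LT_set G) p)].

(* A triple (c, u, g) in s stands for the summand c u g. *)
Definition red_step (F : {fset T}) (f f' : T) : Prop :=
  f <> 0 /\
  exists s : seq (R * 'X_{1..k} * T),
  [/\ {in s, forall q, let: (c, u, g) := q in
         [/\ g \in F, c <> 0 & LM f = (u + LM g)%MM]},
      LT f = \sum_(q <- s) (let: (c, u, g) := q in c *: ('X_[u] * LT g)) &
      f' = f - \sum_(q <- s) (let: (c, u, g) := q in c *: ('X_[u] * g))].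

Definition minimal (F : {fset T}) (f : T) : Prop :=
  f <> 0 /\ forall f', ~ red_step F f f'.

Inductive red_many (F : {fset T}) : T -> T -> Prop :=
| red_refl f : red_many F f f
| red_trans f f' r : red_step F f f' -> red_many F f' r -> red_many F f r.

Definition reduces_to (F : {fset T}) (f r : T) : Prop :=
  red_many F f r /\ (r = 0 \/ minimal F r).

(* Homogeneity in the grading by monomials: every nonzero h_i is a term with
   h_i LM(g_i) a multiple of one and the same monomial d. *)
Definition homogeneous_syz (N : nat) (g : 'I_N -> T) (h : 'rV[T]_N) : Prop :=
  exists d : 'X_{1..k}, forall i : 'I_N, h 0 i <> 0 ->
    exists (c : R) (u : 'X_{1..k}),
      h 0 i = c *: 'X_[u] /\ (u + LM (g i))%MM = d.

(* The Groebner basis algorithm is nondeterministic (enumeration of G, choice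
   and order of B, choice of reductions); its runs are described relationally. *)

(* process g B F F': treating the elements of B in the listed order turns
   the current set F into F'. *)
Inductive process (N : nat) (g : 'I_N -> T) :
    seq 'rV[T]_N -> {fset T} -> {fset T} -> Prop :=
| process_nil F : process g [::] F F
| process_cons (h : 'rV[T]_N) B F r F' :
    reduces_to F (\sum_(i < N) h 0 i * g i) r ->
    process g B (if r == 0 then F else (r |` F)%fset) F' ->
    process g (h :: B) F F'.

Definition gb_pass (G G' : {fset T}) : Prop :=
  exists (N : nat) (g : 'I_N -> T) (B : seq 'rV[T]_N),
  [/\ injective g /\ (forall f, f \in G <-> exists i, f = g i),
      uniq B /\ {in B, forall h, homogeneous_syz g h},
      module_generates B (syzygy (fun i => LT (g i))) &
      process g B G G'].

(* gb_loop G G' out: the while loop entered in state (G, G') ends with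
   output out. *)
Inductive gb_loop : {fset T} -> {fset T} -> {fset T} -> Prop :=
| gb_stop G : gb_loop G G G
| gb_iter G G' G'' out :
    G' <> G -> gb_pass G' G'' -> gb_loop G' G'' out -> gb_loop G G' out.

Definition gb_algorithm (S out : {fset T}) : Prop :=
  gb_loop fset0 (S `\ 0)%fset out.

End LeadingTerms.

(* Main.v *)
(** Buchberger's criterion makes the output [G] of the algorithm a Groebner
    basis of [J]: a sum [sum_q c_q u_q g_q] whose top degree cancels can be
    rewritten in lower degree, because its top part is a syzygy of the leading
    terms and the basic syzygies reduce to 0 when the algorithm stops.

    Let [p <> 0] lie in [Jbar] and involve only the x variables. As [I] is
    contained in [J], [p] lifts to some [F] in [J] with the same leading
    monomial. In an expression of [LT F] by the [LT g] with [g] in [G], the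
    terms with [LC g] in [I] vanish modulo [I]; for the others
    [LM (phi g) = LM g] divides [LM F], so it involves only x variables, and so
    does [phi g] because the order is an elimination order. *)

Require Import Defs.
From HB Require Import structures.
From mathcomp Require Import all_boot all_order all_algebra.
From mathcomp Require Import finmap mpoly.

Set Implicit Arguments.
Unset Strict Implicit.
Unset Printing Implicit Defensive.

Import GRing.Theory.
Local Open Scope ring_scope.
Local Open Scope quotient_scope.

(** * Ideals generated by a predicate *)

Lemma is_ideal_sum (R : comNzRingType) (J : R -> Prop) (K : eqType) (s : seq K)
    (P : pred K) (E : K -> R) :
  is_ideal J -> {in s, forall q, P q -> J (E q)} -> J (\sum_(q <- s | P q) E q).
Proof.
case=> J0 JD _ JE; rewrite big_seq_cond.
by apply: big_ind => // q /andP[]; exact: JE.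
Qed.

Lemma ideal_span_gen (R : comNzRingType) (X : R -> Prop) a :
  X a -> ideal_span X a.
Proof.
move=> Xa; exists [:: (1, a)]; last by rewrite big_seq1 mul1r.
by move=> q; rewrite inE => /eqP->.
Qed.

Lemma ideal_span_ideal (R : comNzRingType) (X : R -> Prop) :
  is_ideal (ideal_span X).
Proof.
split=> [|a b [s Xs ->] [s' Xs' ->]|c a [s Xs ->]].
- by exists [::]; rewrite ?big_nil.
- exists (s ++ s'); last by rewrite big_cat.
  by move=> q; rewrite mem_cat => /orP[]; [exact: Xs | exact: Xs'].
- exists [seq (c * q.1, q.2) | q <- s].
    by move=> q /mapP[q' sq' ->] /=; exact: Xs.
  by rewrite big_map mulr_sumr; apply: eq_bigr => q _; rewrite mulrA.
Qed.

Lemma ideal_span_least (R : comNzRingType) (X J : R -> Prop) :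
  is_ideal J -> (forall a, X a -> J a) -> forall a, ideal_span X a -> J a.
Proof.
move=> idJ XJ _ [s Xs ->]; apply: is_ideal_sum => // q /Xs Xq _.
by case: idJ => _ _; apply; exact: XJ.
Qed.

(** * Leading monomials *)

Section MonomialOrder.
Variables (R : comNzRingType) (k : nat) (lt : rel 'X_{1..k}).
Hypothesis lt_mo : monomial_order lt.
Local Notation T := {mpoly R[k]}.
Local Notation LM := (LM lt).
Local Notation LC := (LC lt).
Local Notation LT := (LT lt).

Let lt_irr : irreflexive lt. Proof. by case: lt_mo. Qed.
Let lt_trans : transitive lt. Proof. by case: lt_mo. Qed.
Let lt_total a b : a != b -> lt a b || lt b a.
Proof. by case: lt_mo => _ _ /(_ a b). Qed.

(** By irreflexivity and transitivity at most one monomial dominates the support, so the [head] in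
    [LM] does not depend on how [msupp] lists it. *)
Lemma LM_unique (f : T) u :
  u \in msupp f -> {in msupp f, forall v, (v == u) || lt v u} -> LM f = u.
Proof.
move=> fu le_u; rewrite /Defs.LM.
have: u \in [seq u <- msupp f | all (fun v => (v == u) || lt v u) (msupp f)].
  by rewrite mem_filter fu andbT; apply/allP.
case Es: [seq _ <- _ | _] => [//|w s] _ /=.
have: w \in w :: s by rewrite mem_head.
rewrite -Es mem_filter => /andP[/allP/(_ u fu)/orP[/eqP-> //|lt_uw] /le_u].
by case/orP=> [/eqP // | /(lt_trans lt_uw)]; rewrite lt_irr.
Qed.

Lemma LM_spec (f : T) : f != 0 ->
  LM f \in msupp f /\ {in msupp f, forall v, (v == LM f) || lt v (LM f)}.
Proof.
rewrite -msupp_eq0 => f0.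
suff [u su le_u]: exists2 u, u \in msupp f &
    {in msupp f, forall v, (v == u) || lt v u} by rewrite (LM_unique su le_u).
elim: (msupp f) f0 => // w s IHs _; have [->|/IHs[u su le_u]] := eqVneq s [::].
  by exists w => [|v]; rewrite inE // => ->.
have [lt_wu|nlt_wu] := boolP (lt w u).
  exists u => [|v]; first by rewrite inE su orbT.
  by rewrite inE => /orP[/eqP->|/le_u//]; rewrite lt_wu orbT.
exists w => [|v]; first exact: mem_head.
rewrite inE => /orP[-> //|/le_u /orP[/eqP->|lt_vu]].
  by have [//|/lt_total] := eqVneq u w; rewrite (negPf nlt_wu) orbF.
have [<-|/lt_total] := eqVneq u w; first by rewrite lt_vu orbT.
by rewrite (negPf nlt_wu) orbF => /(lt_trans lt_vu)->; rewrite orbT.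
Qed.

Lemma LM_msupp (f : T) : f != 0 -> LM f \in msupp f.
Proof. by move=> /LM_spec[]. Qed.

Lemma LM_ge (f : T) v : v \in msupp f -> (v == LM f) || lt v (LM f).
Proof.
move=> fv; have [f0|/LM_spec[_]] := eqVneq f 0; last exact.
by rewrite f0 msupp0 in fv.
Qed.

End MonomialOrder.

(** * Buchberger's criterion over a coefficient ring *)

Section Buchberger.
Variables (R : comNzRingType) (k : nat) (lt : rel 'X_{1..k}).
Hypothesis lt_mo : monomial_order lt.
Local Notation T := {mpoly R[k]}.
Local Notation LM := (LM lt).
Local Notation LC := (LC lt).
Local Notation LT := (LT lt).
Local Notation le u v := ((u == v) || lt u v).

Let lt_irr : irreflexive lt. Proof. by case: lt_mo. Qed.
Let lt_trans : transitive lt. Proof. by case: lt_mo. Qed.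
Let lt_total a b : a != b -> lt a b || lt b a.
Proof. by case: lt_mo => _ _ /(_ a b). Qed.
Let lt_add a b c : lt a b -> lt (a + c)%MM (b + c)%MM.
Proof. by case: lt_mo => _ _ _ /(_ a b c). Qed.

(** If [u < 0], translation gives [u + u < u], hence [u + u < 0] with [u + u] strictly smaller: an
    infinite descent. *)
Lemma lt0_false u : lt u 0%MM = false.
Proof.
case: lt_mo => _ _ _ _ wf; elim/(well_founded_ind wf): u => u IHu.
apply/negP => lt_u0; have := lt_add u lt_u0; rewrite add0m => lt_uu.
by have := IHu _ lt_uu; rewrite (lt_trans lt_uu lt_u0).
Qed.

Lemma le_trans_lt u v w : le u v -> lt v w -> lt u w.
Proof. by case/orP=> [/eqP->//|]; exact: lt_trans. Qed.

Lemma mcoeff_term (c : R) u (g : T) w : (c *: ('X_[u] * g))@_(u + w) = c * g@_w.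
Proof. by rewrite mcoeffZ ['X_[u] * g]mulrC mcoeffMX. Qed.

Lemma msupp_term (c : R) u (g : T) v :
  v \in msupp (c *: ('X_[u] * g)) -> le v (u + LM g)%MM.
Proof.
move=> /msuppZ_le; rewrite mulrC (perm_mem (msuppMX _ _)) => /mapP[w gw ->].
have := LM_ge lt_mo gw => /orP[/eqP<-|lt_w].
  by rewrite eqxx.
by rewrite ![(u + _)%MM]addmC lt_add ?orbT.
Qed.

Definition supp_lt D (f : T) := {in msupp f, forall v, lt v D}.

Lemma supp_ltD D f g : supp_lt D f -> supp_lt D g -> supp_lt D (f + g).
Proof.
move=> ltf ltg v /msuppD_le; rewrite mem_cat.
by case/orP; [exact: ltf | exact: ltg].
Qed.

Lemma supp_ltN D f : supp_lt D f -> supp_lt D (- f).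
Proof. by move=> ltf v; rewrite (perm_mem (msuppN _)); exact: ltf. Qed.

Lemma supp_lt_sum D (K : eqType) (s : seq K) (E : K -> T) :
  {in s, forall q, supp_lt D (E q)} -> supp_lt D (\sum_(q <- s) E q).
Proof.
move=> ltE; rewrite big_seq; apply: (big_ind (supp_lt D)) => //.
  by move=> v; rewrite msupp0.
exact: supp_ltD.
Qed.

Section Representation.
Variable G : {fset T}.

(** [P] constrains the formal degrees [u + LM g] of the summands [c u g]. As [c * LC g] may vanish,
    a formal degree only bounds the monomials that occur. *)
Definition rep (P : 'X_{1..k} -> Prop) (f : T) : Prop :=
  exists2 s : seq (R * 'X_{1..k} * T),
    {in s, forall q, q.2 \in G /\ P (q.1.2 + LM q.2)%MM} &
    f = \sum_(q <- s) q.1.1 *: ('X_[q.1.2] * q.2).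

Lemma rep0 P : rep P 0.
Proof. by exists [::] => //; rewrite big_nil. Qed.

Lemma repD P f g : rep P f -> rep P g -> rep P (f + g).
Proof.
case=> [s Ps ->] [s' Ps' ->]; exists (s ++ s'); last by rewrite big_cat.
by move=> q; rewrite mem_cat => /orP[]; [exact: Ps | exact: Ps'].
Qed.

Lemma rep_sum P (K : eqType) (s : seq K) (E : K -> T) :
  {in s, forall q, rep P (E q)} -> rep P (\sum_(q <- s) E q).
Proof.
move=> PE; rewrite big_seq; apply: big_ind => //; first exact: rep0.
by move=> ? ?; exact: repD.
Qed.

Lemma rep_term (P : _ -> Prop) c u g :
  g \in G -> P (u + LM g)%MM -> rep P (c *: ('X_[u] * g)).
Proof.
move=> Gg Pg; exists [:: (c, u, g)]; last by rewrite big_seq1.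
by move=> q; rewrite inE => /eqP->.
Qed.

Lemma rep_shift D c e f :
  rep (fun v => lt v D) f ->
  rep (fun v => lt v (e + D)%MM) (c *: ('X_[e] * f)).
Proof.
case=> s Ps ->; rewrite mulr_sumr scaler_sumr; apply: rep_sum => q /Ps[Gq ltq].
rewrite -scalerAr scalerA mulrA -mpolyXD; apply: rep_term => //.
by rewrite -addmA ![(e + _)%MM]addmC lt_add.
Qed.

Lemma rep_span f : ideal_span (fun g => g \in G) f -> rep (fun _ => True) f.
Proof.
case=> s Gs ->; apply: rep_sum => q /Gs Gq.
rewrite [q.1]mpolyE mulr_suml; apply: rep_sum => u _.
by rewrite -scalerAl; exact: rep_term.
Qed.

(** [D] is the largest formal degree that occurs, so it satisfies [P] itself. With [P] a strict
    bound this yields the descent in [LT_rep]. *)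
Lemma rep_bound (P : _ -> Prop) f :
  rep P f -> f = 0 \/ exists2 D, P D & rep (fun v => le v D) f.
Proof.
case=> s Ps ->; elim: s Ps => [|q s IHs] Ps; first by left; rewrite big_nil.
right; have [Gq Pq] := Ps q (mem_head _ _); rewrite big_cons.
have [|->|[D PD repD']] := IHs.
  by move=> q' sq'; apply: Ps; rewrite inE sq' orbT.
- exists (q.1.2 + LM q.2)%MM => //; rewrite addr0.
  by apply: rep_term; rewrite ?eqxx.
- have mono D1 D2 f1 : le D1 D2 ->
      rep (fun v => le v D1) f1 -> rep (fun v => le v D2) f1.
    move=> le12 [s1 Ps1 ->]; exists s1 => // q1 /Ps1[-> le1]; split=> //.
    case/orP: le1 => [/eqP->//|lt1]; case/orP: le12 => [/eqP<-|lt12].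
      by rewrite lt1 orbT.
    by rewrite (lt_trans lt1 lt12) orbT.
  set Dq := (q.1.2 + LM q.2)%MM in Pq *.
  have repq: rep (fun v => le v Dq) (q.1.1 *: ('X_[q.1.2] * q.2)).
    by apply: rep_term; rewrite ?eqxx.
  have [ledq|nle] := boolP (le Dq D).
    by exists D => //; apply: repD => //; exact: mono repq.
  exists Dq => //; apply: repD => //; apply: mono repD'.
  move: nle; rewrite negb_or => /andP[/lt_total/orP[->//|->]].
  by rewrite orbT.
Qed.

(** All terms subtracted in a step from [f1] have formal degree [LM f1], which lies in the support
    and so below [D]. The bound thus passes to the next polynomial, and the subtracted terms add up
    to [f]. *)
Lemma rep_red_many D f r :
  red_many lt G f r -> supp_lt D f -> r = 0 -> rep (fun v => lt v D) f.
Proof.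
move=> red; elim: red => {f r} [f1 _ ->|f1 f2 r1]; first exact: rep0.
move=> [/eqP f10 [s [Gs _ ->]]] _ IHr ltf r0.
have ltq q : q \in s -> lt (q.1.2 + LM q.2)%MM D.
  case: q => [[c u] g] /Gs[_ _ <-]; apply: ltf.
  exact: LM_msupp f10.
set h := \sum_(q <- s) _ in IHr *.
have hE : h = \sum_(q <- s) q.1.1 *: ('X_[q.1.2] * q.2).
  by apply: eq_bigr => -[[]].
rewrite -(subrK h f1); apply: repD.
  apply: IHr => //; apply: supp_ltD => //; apply: supp_ltN; rewrite hE.
  apply: supp_lt_sum => q sq v /msupp_term le_v.
  exact: le_trans_lt le_v (ltq q sq).
rewrite hE; apply: rep_sum => -[[c u] g] sq; have [Gg _ _] := Gs _ sq.
by apply: rep_term => //; exact: ltq sq.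
Qed.

End Representation.

(* The part of p which, multiplied by a polynomial of leading monomial L,
   contributes in degree D. *)
Definition part (D L : 'X_{1..k}) (p : T) : T :=
  (p@_(D - L) *+ (L <= D)%MM) *: 'X_[D - L].

Lemma part_sum D L (K : Type) (s : seq K) (P : pred K) (E : K -> T) :
  part D L (\sum_(q <- s | P q) E q) = \sum_(q <- s | P q) part D L (E q).
Proof.
rewrite /part raddf_sum -sumrMnl scaler_suml; exact: eq_bigr.
Qed.

Lemma part_term D L c u :
  part D L (c *: 'X_[u]) = if (u + L == D)%MM then c *: 'X_[u] else 0.
Proof.
rewrite /part mcoeffZ mcoeffX; case: (eqVneq (u + L)%MM D) => [<-|neq_D].
  by rewrite addmK eqxx mulr1 lem_addl.
case: (boolP (L <= D)%MM) => [leLD|_]; last by rewrite mulr0n scale0r.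
case: eqVneq => [uE|_]; last by rewrite mulr0 mul0rn scale0r.
by rewrite uE submK ?eqxx in neq_D.
Qed.

Section Criterion.
Variables (G : {fset T}) (N : nat) (g : 'I_N -> T) (B : seq 'rV[T]_N).
Hypothesis g_inj : injective g.
Hypothesis gG : forall f, f \in G <-> exists i, f = g i.
Hypothesis B_hom : {in B, forall h, homogeneous_syz lt g h}.
Hypothesis B_gen : module_generates B (syzygy (fun i => LT (g i))).
Hypothesis B_red : {in B, forall h : 'rV_N,
  red_many lt G (\sum_(i < N) h 0 i * g i) 0}.

Lemma syz_basis b : b \in B -> syzygy (fun i => LT (g i)) b.
Proof.
move=> Bb; apply/B_gen; exists [:: (1, b)]; last by rewrite big_seq1 scale1r.
by move=> q; rewrite inE => /eqP->.
Qed.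

(** By homogeneity no product [b_i g_i] exceeds degree [d], and the coefficient of the sum at [d] is
    that of [\sum_i LT (g i) * b_i], which is 0. The support is thus strictly below [d], and
    reduction to 0 preserves this bound. *)
Lemma rep_basis b d : b \in B ->
  (forall i, b 0 i <> 0 ->
     exists (c : R) u, b 0 i = c *: 'X_[u] /\ (u + LM (g i))%MM = d) ->
  rep G (fun v => lt v d) (\sum_(i < N) b 0 i * g i).
Proof.
move=> Bb b_hom; apply: rep_red_many (B_red Bb) _ erefl => v fv.
have le_v: le v d.
  move: (msupp_sum_le fv) => /flatten_mapP[i _].
  have [-> | /eqP/b_hom[c [u [-> <-]]]] := eqVneq (b 0 i) 0.
    by rewrite mul0r msupp0.
  by rewrite -scalerAl => /msupp_term.
case/orP: le_v => // /eqP vd; move: fv; rewrite mcoeff_msupp vd => /eqP[].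
have := syz_basis Bb => /(congr1 (mcoeff d)); rewrite mcoeff0 => <-.
rewrite !raddf_sum; apply: eq_bigr => i _ /=.
have [-> | /eqP/b_hom[c [u [-> <-]]]] := eqVneq (b 0 i) 0.
  by rewrite mul0r mulr0.
rewrite -scalerAl mcoeff_term [in RHS]mulrC -scalerAl mcoeff_term.
by rewrite /Defs.LT mcoeffZ mcoeffX eqxx mulr1.
Qed.

(** Write [h] as a combination of basic syzygies [b] with polynomial coefficients [p]. In degree [D]
    only the monomials [e] of [p] with [e + d = D] contribute, each giving a shift by [e] of a
    representation below [d]. *)
Lemma rep_syzygy D h :
  syzygy (fun i => LT (g i)) h ->
  rep G (fun v => lt v D) (\sum_(i < N) part D (LM (g i)) (h 0 i) * g i).
Proof.
case/B_gen => s Bs ->.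
under eq_bigr => i _ do rewrite summxE part_sum mulr_suml.
rewrite exchange_big; apply: rep_sum => -[p b] /Bs /= Bb.
have [d b_hom] := B_hom Bb.
(* All nonzero entries of [b] have degree [d], so a multiple by ['X_[e]] lives in degree [e + d]
   alone. *)
have termE (c : R) e i : part D (LM (g i)) ((c *: 'X_[e]) * b 0 i) =
    if (e + d == D)%MM then (c *: 'X_[e]) * b 0 i else 0.
  have [-> | /eqP/b_hom[c' [u [-> <-]]]] := eqVneq (b 0 i) 0.
    by rewrite mulr0 /part mcoeff0 mul0rn scale0r if_same.
  by rewrite -scalerAl -scalerAr scalerA -mpolyXD part_term addmA.
have -> : \sum_(i < N) part D (LM (g i)) ((p *: b) 0 i) * g i =
  \sum_(e <- msupp p) (if (e + d == D)%MM
     then p@_e *: ('X_[e] * \sum_(i < N) b 0 i * g i) else 0).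
  under eq_bigr => i _.
    rewrite mxE {1}[p]mpolyE mulr_suml part_sum mulr_suml.
    under eq_bigr => e _ do rewrite termE.
    over.
  rewrite exchange_big; apply: eq_bigr => e _; case: eqP => _.
    rewrite mulr_sumr scaler_sumr; apply: eq_bigr => i _.
    by rewrite mulrA -!scalerAl.
  by rewrite big1 // => i _; rewrite mul0r.
apply: rep_sum => e _; case: eqP => [<-|_]; last exact: rep0.
exact: rep_shift (rep_basis Bb b_hom).
Qed.

(** Well-founded induction on the bound [D]: either [D] is the leading monomial of [f] and the top
    summands express [LT f], or the top summands cancel in degree [D] and the bound can be
    lowered. *)
Lemma LT_rep D f :
  rep G (fun v => le v D) f -> f <> 0 ->
  ideal_span (LT_set lt (fun p => p \in G)) (LT f).
Proof.
case: lt_mo => _ _ _ _ wf; elim/(well_founded_ind wf): D f => D IHD f.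
case=> s Gs fE f0; pose top (q : R * 'X_{1..k} * T) := (q.1.2 + LM q.2 == D)%MM.
have supp_f v : v \in msupp f -> le v D.
  rewrite fE => /msupp_sum_le /flatten_mapP[q].
  rewrite filter_predT => /Gs[_ leq] /msupp_term.
  case/orP=> [/eqP-> //|ltq]; case/orP: leq => [/eqP<-|ltD].
    by rewrite ltq orbT.
  by rewrite (lt_trans ltq ltD) orbT.
have topE : f@_D *: 'X_[D] =
    \sum_(q <- s | top q) q.1.1 *: ('X_[q.1.2] * LT q.2).
  rewrite {1}fE raddf_sum /= scaler_suml (bigID top) /= [X in _ + X]big1_seq.
    rewrite addr0; apply: eq_bigr => q /eqP<-; rewrite mcoeff_term /Defs.LT.
    by rewrite -scalerAr scalerA -mpolyXD.
  move=> q /andP[ntop /Gs[_ /orP[/eqP eqD|ltD]]].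
    by rewrite /top eqD eqxx in ntop.
  rewrite memN_msupp_eq0 ?scale0r //; apply/negP => /msupp_term.
  by move=> /le_trans_lt/(_ ltD); rewrite lt_irr.
have [fD0|fD0] := eqVneq (f@_D) 0; last first.
  have LMf : LM f = D.
    by apply: LM_unique => //; rewrite mcoeff_msupp.
  rewrite /Defs.LT /Defs.LC LMf topE; apply: is_ideal_sum.
    exact: ideal_span_ideal.
  move=> q /Gs[Gq _] _.
  (* Membership of 0 in [G] is not excluded here; its leading term is 0. *)
  have [->|q0] := eqVneq q.2 0.
    rewrite /Defs.LT /Defs.LC mcoeff0 scale0r mulr0 scaler0.
    by case: (ideal_span_ideal (LT_set lt (fun p => p \in G))).
  rewrite -mul_mpolyC mulrA.
  case: (ideal_span_ideal (LT_set lt (fun p => p \in G))) => _ _; apply.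
  by apply: ideal_span_gen; exists q.2; split=> //; apply/eqP.
(* The summands of degree D form a syzygy of the leading terms, so that they
   can be rewritten in lower degree. *)
pose h := \row_i \sum_(q <- s | top q && (q.2 == g i)) q.1.1 *: 'X_[q.1.2].
(* Since [g] is injective, each top summand is counted in exactly one entry of [h]. This is applied
   with [E] equal to [LT], for the syzygy equation, and to [id], for the top part of [f]. *)
have hE (E : T -> T) : \sum_(i < N) h 0 i * E (g i) =
    \sum_(q <- s | top q) q.1.1 *: ('X_[q.1.2] * E q.2).
  under eq_bigr => i _ do rewrite mxE mulr_suml -big_filter_cond.
  rewrite (exchange_big_dep predT) //= big_filter.
  rewrite big_seq_cond [RHS]big_seq_cond.
  apply: eq_bigr => q /andP[/Gs[/gG[i qE] _] _].
  rewrite (big_pred1 i) => [|j]; last by rewrite qE (inj_eq g_inj) eq_sym.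
  by rewrite -qE scalerAl.
(* The entries of [h] already are their own parts in degree [D], which brings the top part of [f]
   into the form of [rep_syzygy]. *)
have h_part i : part D (LM (g i)) (h 0 i) = h 0 i.
  rewrite mxE part_sum; apply: eq_bigr => q /andP[topq /eqP qE].
  by rewrite part_term -qE; move: topq; rewrite /top => ->.
have h_syz : syzygy (fun i => LT (g i)) h.
  rewrite /syzygy; under eq_bigr => i _ do rewrite mulrC.
  by rewrite hE -topE fD0 scale0r.
have repf : rep G (fun v => lt v D) f.
  rewrite fE (bigID top) /=; apply: repD.
    rewrite -(hE id).
    rewrite -(eq_bigr _ (fun i _ => congr1 ( *%R^~ (g i)) (h_part i))).
    exact: rep_syzygy.
  rewrite -big_filter; apply: rep_sum => q; rewrite mem_filter.
  case/andP=> ntop /Gs[Gq leq]; apply: rep_term => //.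
  by move: leq ntop; rewrite /top => /orP[->|].
have [//|[D' ltD' rep']] := rep_bound repf.
exact: IHD ltD' _ rep' f0.
Qed.

Lemma buchberger f :
  ideal_span (fun p => p \in G) f -> f <> 0 ->
  ideal_span (LT_set lt (fun p => p \in G)) (LT f).
Proof.
move=> /rep_span/rep_bound[-> []//|[D _]]; exact: LT_rep.
Qed.

End Criterion.
End Buchberger.

(** * Invariants of the Groebner basis algorithm *)

Section Algorithm.
Variables (R : comNzRingType) (k : nat) (lt : rel 'X_{1..k}).
Local Notation T := {mpoly R[k]}.
Local Notation span G := (ideal_span (fun p : T => p \in (G : {fset T}))).

Lemma ideal_span_fset_ideal (F : {fset T}) : is_ideal (span F).
Proof. exact: ideal_span_ideal. Qed.

Lemma ideal_span_mem (F : {fset T}) f : f \in F -> span F f.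
Proof. exact: (@ideal_span_gen _ (fun p => p \in F)). Qed.

Lemma ideal_span_fsetS (F F' : {fset T}) f :
  (F `<=` F')%fset -> span F f -> span F' f.
Proof.
move=> /fsubsetP sFF'; apply: ideal_span_least; first exact: ideal_span_ideal.
by move=> g /sFF'; exact: ideal_span_mem.
Qed.

Lemma red_many_span (F : {fset T}) f r :
  red_many lt F f r -> span F f -> span F r.
Proof.
elim=> // f1 f2 r1 [_ [s [Fs _ ->]]] _ IHr spf; apply: IHr.
have idF := ideal_span_fset_ideal F; have [_ spD spM] := idF.
rewrite -mulN1r; apply: (spD) => //; apply: (spM); apply: is_ideal_sum => //.
move=> [[c u] g] /Fs[Fg _ _] _; rewrite -mul_mpolyC mulrA; apply: spM.
exact: ideal_span_mem.
Qed.

(** Each added remainder differs from a combination of the [g i] by multiples of elements of the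
    current set, so the ideal never grows. *)
Lemma process_span N (g : 'I_N -> T) B F F' :
  process lt g B F F' -> (forall i, span F (g i)) ->
  forall f, span F' f <-> span F f.
Proof.
elim=> // h B1 F1 r F1' [red_r _] _ IH spg f.
have spr : span F1 r.
  apply: red_many_span red_r _; apply: is_ideal_sum => [|i _ _].
    exact: ideal_span_fset_ideal.
  by case: (ideal_span_fset_ideal F1) => _ _; apply.
move: IH; case: eqVneq => [_|_] IH; first exact: IH.
have sub1 := @ideal_span_fsetS _ _ _ (fsubsetU1 r F1).
rewrite IH => [|i]; last exact: sub1.
split; last exact: sub1.
apply: ideal_span_least; first exact: ideal_span_fset_ideal.
by move=> q; rewrite inE => /orP[/fset1P->|/ideal_span_mem].
Qed.

Lemma gb_loop_span (F F' G : {fset T}) :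
  gb_loop lt F F' G -> forall f, span G f <-> span F' f.
Proof.
elim=> // F1 F1' F1'' G1 _ [N [g [B [[_ gF] _ _ pr]]]] _ IH f; rewrite IH.
apply: process_span pr _ f => i.
by apply: ideal_span_mem; apply/gF; exists i.
Qed.

Lemma gb_algorithm_span (S G : {fset T}) :
  gb_algorithm lt S G -> forall f, span G f <-> span S f.
Proof.
move=> run f; rewrite (gb_loop_span run); split.
  exact/ideal_span_fsetS/fsubD1set.
apply: ideal_span_least; first exact: ideal_span_fset_ideal.
move=> g Sg; have [->|g0] := eqVneq g 0.
  by case: (ideal_span_fset_ideal (S `\ 0)%fset).
by apply: ideal_span_mem; rewrite !inE g0.
Qed.

Lemma process_subset N (g : 'I_N -> T) B F F' :
  process lt g B F F' -> (F `<=` F')%fset.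
Proof.
elim=> // h B1 F1 r F1' _ _; case: eqP => // _.
by apply: fsubset_trans; exact: fsubsetU1.
Qed.

Hypothesis lt_mo : monomial_order lt.

(** An element of [F] reduces to 0 by subtracting itself. *)
Lemma minimal_notin (F : {fset T}) r : minimal lt F r -> r \notin F.
Proof.
case=> r0 min_r; apply/negP => Fr; apply: (min_r (r - r)); split=> //.
exists [:: (1, 0%MM, r)]; split; rewrite ?big_seq1 ?scale1r ?mpolyX0 ?mul1r //.
move=> q; rewrite inE => /eqP->; rewrite add0m; split=> //.
by apply/eqP; exact: oner_neq0.
Qed.

(** The current set only grows, and a nonzero remainder, being minimal, would be a new element. If
    the set is unchanged at the end, every remainder was 0. *)
Lemma process_fixed N (g : 'I_N -> T) B F F' :
  process lt g B F F' -> F = F' ->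
  {in B, forall h : 'rV_N, red_many lt F (\sum_(i < N) h 0 i * g i) 0}.
Proof.
elim=> // h B1 F1 r F1' [red_r min_r] pr IH FE.
move: (process_subset pr) IH; have [r0 _ IH b|r0 sF _] := eqVneq r 0.
  by rewrite inE => /orP[/eqP->|/(IH FE)//]; rewrite -{2}r0.
case: min_r => [/eqP|/minimal_notin rF]; first by rewrite (negPf r0).
by move/fsubsetP/(_ r): sF; rewrite -FE fset1U1 (negPf rF) => /(_ isT).
Qed.

(** The loop stops on two equal sets, so its last pass left the set unchanged. The premise is the
    loop invariant; with no pass at all the output is the initial [fset0]. *)
Lemma gb_loop_fixed (F F' G : {fset T}) : gb_loop lt F F' G ->
  (F = F' -> F' = fset0 \/ gb_pass lt F' F') -> G = fset0 \/ gb_pass lt G G.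
Proof.
elim=> [G1|F1 F1' F1'' G1 _ pass _ IH _]; first exact.
by apply: IH => E; right; rewrite -{1}E.
Qed.

Lemma gb_algorithm_LT S G f :
  gb_algorithm lt S G -> span G f -> f <> 0 ->
  ideal_span (LT_set lt (fun p => p \in G)) (LT lt f).
Proof.
move=> run; have [-> //||] := gb_loop_fixed run; first by left.
  (* For empty [G] the ideal is zero, against [f <> 0]. *)
  by move=> -> [s s0 ->] []; rewrite big_seq big1 // => q /s0.
case=> N [g [B [[g_inj gG] [_ B_hom] B_gen pr]]].
exact: (buchberger lt_mo g_inj gG B_hom B_gen (process_fixed pr erefl)).
Qed.

End Algorithm.

(** * Reduction of coefficients along a ring morphism *)

Section CoefficientMap.
Variables (R A : comNzRingType) (h : {rmorphism R -> A}) (k : nat).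
Variable lt : rel 'X_{1..k}.
Hypothesis lt_mo : monomial_order lt.
Local Notation T := {mpoly R[k]}.

Lemma LM_map (g : T) : h (LC lt g) != 0 ->
  LM lt (map_mpoly h g) = LM lt g.
Proof.
move=> hg.
apply: LM_unique => // [|v]; rewrite mcoeff_msupp mcoeff_map_mpoly //.
move=> hv; apply: LM_ge => //; rewrite mcoeff_msupp.
by apply: contraNneq hv => ->; rewrite raddf0.
Qed.

Lemma ideal_span_lift (h_surj : forall a, exists b, h b = a)
    (J : T -> Prop) (X : {mpoly A[k]} -> Prop) p :
  is_ideal J -> (forall q, X q -> exists2 g, J g & map_mpoly h g = q) ->
  ideal_span X p -> exists2 F, J F & map_mpoly h F = p.
Proof.
move=> idJ XJ; have [J0 JD JM] := idJ.
have lift (q : {mpoly A[k]}) : exists F : T, map_mpoly h F = q.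
  elim/mpolyind: q => [|c u q _ _ [F <-]]; first by exists 0; rewrite rmorph0.
  have [b <-] := h_surj c; exists (b *: 'X_[u] + F).
  by rewrite rmorphD /= map_mpolyZ map_mpolyX.
case=> s; elim: s p => [|q s IHs] p Xs ->.
  by exists 0; rewrite ?rmorph0 ?big_nil.
have [F JF FE] : exists2 F, J F & map_mpoly h F = \sum_(q <- s) q.1 * q.2.
  by apply: IHs => // q' sq'; apply: Xs; rewrite inE sq' orbT.
have [g Jg gE] := XJ _ (Xs q (mem_head _ _)); have [a aE] := lift q.1.
exists (a * g + F); last by rewrite rmorphD rmorphM /= aE gE FE big_cons.
by apply: (JD) => //; exact: JM.
Qed.

(** Delete from [F] the terms whose coefficients lie in the kernel: they belong to [J] and map to 0.
    Every remaining coefficient, in particular the leading one, has nonzero image. *)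
Lemma lift_LC (J : T -> Prop) (idJ : is_ideal J) F :
  (forall a, h a = 0 -> J a%:MP) -> J F -> map_mpoly h F != 0 ->
  exists F', [/\ J F', map_mpoly h F' = map_mpoly h F & h (LC lt F') != 0].
Proof.
have [_ JD JM] := idJ.
move=> kerJ JF hF0.
pose E : T := \sum_(u <- msupp F | h F@_u == 0) F@_u *: 'X_[u].
have hE : map_mpoly h E = 0.
  rewrite rmorph_sum big1 // => u /eqP hu.
  by rewrite /= map_mpolyZ hu scale0r.
have FE : F - E = \sum_(u <- msupp F | h F@_u != 0) F@_u *: 'X_[u].
  rewrite {1}[F]mpolyE (bigID (fun u => h F@_u == 0)) /= -/E.
  by rewrite addrAC subrr add0r.
have hFE : map_mpoly h (F - E) = map_mpoly h F by rewrite rmorphB /= hE subr0.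
exists (F - E); split=> //.
  apply: (JD) => //; rewrite -mulN1r; apply: (JM).
  apply: is_ideal_sum => // u _ /eqP hu.
  by rewrite -mul_mpolyC mulrC; apply/JM/kerJ.
have /(LM_msupp lt_mo) : F - E != 0.
  by apply: contraNneq hF0 => FE0; rewrite -hFE FE0 rmorph0.
have hv v : h (F - E)@_v = h F@_v by rewrite -!mcoeff_map_mpoly hFE.
rewrite /LC; move: (LM lt _) => v.
rewrite hv FE => /msupp_sum_le /flatten_mapP[u].
by rewrite mem_filter => /andP[hu _] /msuppZ_le; rewrite msuppX inE => /eqP->.
Qed.

End CoefficientMap.

(** * Splitting the variables and elimination *)

Section Elimination.
Variables (n m : nat).
Implicit Types (a : 'X_{1..n}) (b : 'X_{1..m}) (u : 'X_{1..n + m}).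

Definition xpart u : 'X_{1..n} := [multinom u (lshift m i) | i < n].
Definition ypart u : 'X_{1..m} := [multinom u (rshift n i) | i < m].

Lemma mon_xy_lshift a b i : mon_xy a b (lshift m i) = a i.
Proof. by rewrite mnmE -[lshift m i]/(unsplit (inl i)) unsplitK. Qed.

Lemma mon_xy_rshift a b i : mon_xy a b (rshift n i) = b i.
Proof. by rewrite mnmE -[rshift n i]/(unsplit (inr i)) unsplitK. Qed.

Lemma xpartK a b : xpart (mon_xy a b) = a.
Proof. by apply/mnmP=> i; rewrite mnmE mon_xy_lshift. Qed.

Lemma ypartK a b : ypart (mon_xy a b) = b.
Proof. by apply/mnmP=> i; rewrite mnmE mon_xy_rshift. Qed.

Lemma mon_xyK u : mon_xy (xpart u) (ypart u) = u.
Proof.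
by apply/mnmP=> i; rewrite mnmE; case: split_ordP => j ->; rewrite mnmE.
Qed.

Lemma xpartD u v : xpart (u + v) = (xpart u + xpart v)%MM.
Proof. by apply/mnmP=> i; rewrite !mnmE. Qed.

Lemma ypartD u v : ypart (u + v) = (ypart u + ypart v)%MM.
Proof. by apply/mnmP=> i; rewrite !mnmE. Qed.

Lemma mon_xyD a a' b b' :
  mon_xy (a + a')%MM (b + b')%MM = (mon_xy a b + mon_xy a' b')%MM.
Proof. by apply/mnmP=> i; rewrite !mnmE; case: split => j; rewrite mnmE. Qed.

Lemma mon_xy0 : mon_xy 0%MM 0%MM = 0%MM :> 'X_{1..n + m}.
Proof. by apply/mnmP=> i; rewrite !mnmE; case: split => j; rewrite mnmE. Qed.

Section Embedding.
Variable R : comNzRingType.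
Implicit Types (p : {mpoly R[n]}) (g : {mpoly R[n + m]}).

Lemma embed_xX a : embed_x m 'X_[a] = 'X_[R, mon_xy a 0%MM].
Proof.
rewrite /embed_x comp_mpolyX [RHS]mpolyXE_id big_split_ord /=.
rewrite [X in _ = _ * X]big1 => [|i _]; last first.
  by rewrite mon_xy_rshift mnm0E expr0.
rewrite mulr1; apply: eq_bigr => i _.
by rewrite tnth_mktuple mon_xy_lshift.
Qed.

Lemma embed_xE p : embed_x m p = \sum_(a <- msupp p) p@_a *: 'X_[mon_xy a 0%MM].
Proof.
rewrite {1}[p]mpolyE /embed_x raddf_sum; apply: eq_bigr => a _ /=.
by rewrite comp_mpolyZ -/(embed_x m 'X_[a]) embed_xX.
Qed.

Lemma mcoeff_embed_x p a : (embed_x m p)@_(mon_xy a 0%MM) = p@_a.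
Proof.
rewrite embed_xE {3}[p]mpolyE !raddf_sum /=; apply: eq_bigr => a' _.
rewrite !mcoeffZ !mcoeffX; congr (_ * (nat_of_bool _)%:R).
by apply/eqP/eqP => [/(congr1 xpart)|->//]; rewrite !xpartK.
Qed.

Lemma msupp_embed_x p u :
  u \in msupp (embed_x m p) -> exists2 a, a \in msupp p & u = mon_xy a 0%MM.
Proof.
rewrite embed_xE => /msupp_sum_le /flatten_mapP[a]; rewrite filter_predT => pa.
by move=> /msuppZ_le; rewrite msuppX inE => /eqP->; exists a.
Qed.

(* Sets the y variables to 1. *)
Definition retract_x g : {mpoly R[n]} :=
  \sum_(u <- msupp g) g@_u *: 'X_[xpart u].

Lemma retract_xK g :
  {in msupp g, forall u, ypart u = 0%MM} -> embed_x m (retract_x g) = g.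
Proof.
move=> g_x; rewrite /embed_x raddf_sum [RHS]mpolyE !big_seq /=.
apply: eq_bigr => u /g_x yu0.
by rewrite comp_mpolyZ -/(embed_x m 'X_[_]) embed_xX -yu0 mon_xyK.
Qed.

Lemma embed_x_inj : injective (@embed_x R n m).
Proof.
by move=> p q pq; apply/mpolyP => a; rewrite -!mcoeff_embed_x pq.
Qed.

Lemma embed_xK p : retract_x (embed_x m p) = p.
Proof.
apply/embed_x_inj/retract_xK => u /msupp_embed_x[a _ ->].
exact: ypartK.
Qed.

End Embedding.

Variable lt : rel 'X_{1..n + m}.
Hypothesis lt_elim : elimination_order lt.

Let lt_mo : monomial_order lt. Proof. by case: lt_elim. Qed.

Lemma restrict_x_order : monomial_order (restrict_x lt).
Proof.
case: lt_mo => lt_irr lt_trans lt_total lt_add wf; split=> [a|b a c|a b|a b c|].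
- exact: lt_irr.
- exact: lt_trans.
- move=> neq_ab; apply: lt_total; apply: contraNneq neq_ab.
  by move=> /(congr1 xpart); rewrite !xpartK => ->.
- by move=> /(lt_add _ _ (mon_xy c 0%MM)); rewrite -!mon_xyD addm0.
(* Well-foundedness is pulled back along the embedding of x monomials: the induction runs on the
   image [u], with [a] general. *)
- move=> a; have [u] : exists u, mon_xy a 0%MM = u by eexists.
  elim/(well_founded_ind wf): u a => u IHu a aE.
  by constructor=> a' lt_a'; apply: IHu (erefl _); rewrite -aE.
Qed.

(** The elimination property leaves two cases: the y part of [u] is below 1, which is impossible, or
    it equals 1. *)
Lemma ypart_lt0 u a : lt u (mon_xy a 0%MM) -> ypart u = 0%MM.
Proof.
case: lt_elim => _ elim; rewrite -{1}(mon_xyK u) => /elim[|[]//].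
by rewrite mon_xy0 (lt0_false lt_mo).
Qed.

Lemma LM_embed_x (R : comNzRingType) (p : {mpoly R[n]}) : p != 0 ->
  LM lt (embed_x m p) = mon_xy (LM (restrict_x lt) p) 0%MM.
Proof.
move=> p0; apply: LM_unique => // [|u /msupp_embed_x[a pa ->]].
  rewrite mcoeff_msupp mcoeff_embed_x -mcoeff_msupp.
  exact: (LM_msupp restrict_x_order).
by have /orP[/eqP->|lt_a] := LM_ge restrict_x_order pa; apply/orP; [left|right].
Qed.

Lemma mcoeffM_LT (R : comNzRingType) (c g : {mpoly R[n + m]}) D :
  (c * LT lt g)@_D =
  if (LM lt g <= D)%MM then c@_(D - LM lt g) * LC lt g else 0.
Proof.
rewrite /LT -scalerAr mcoeffZ mulrC; case: ifP => [leD|nleD].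
  by rewrite -{1}(submK leD) addmC mcoeffMX.
rewrite memN_msupp_eq0 ?mul0r //; apply: contraFN nleD.
by rewrite (perm_mem (msuppMX _ _)) => /mapP[u _ ->]; exact: lem_addr.
Qed.

(** Only the coefficient at [LM F] of the expression of [LT F] is used: its image under [h] is
    [LC p], written as a sum of multiples of the [h (LC g)]. *)
Lemma LT_elimination (R A : comNzRingType) (h : {rmorphism R -> A})
    (G : {fset {mpoly R[n + m]}}) F (p : {mpoly A[n]}) :
  ideal_span (LT_set lt (fun g => g \in G)) (LT lt F) ->
  h (LC lt F) != 0 -> map_mpoly h F = embed_x m p ->
  ideal_span
    (LT_set (restrict_x lt)
       (fun q => exists2 g, g \in G & embed_x m q = map_mpoly h g))
    (LT (restrict_x lt) p).
Proof.
case=> s Gs LTF hF Fp.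
set X := LT_set _ _; have idX := ideal_span_ideal X; have [X0 _ XM] := idX.
have p0 : p != 0.
  apply: contraNneq hF => p0; move/(congr1 (mcoeff (LM lt F))): Fp.
  by rewrite mcoeff_map_mpoly p0 /embed_x raddf0 mcoeff0 => ->.
have LMF : LM lt F = mon_xy (LM (restrict_x lt) p) 0%MM.
  by rewrite -(LM_map lt_mo hF) Fp LM_embed_x.
have LCp : LC (restrict_x lt) p = \sum_(q <- s) h (q.1 * q.2)@_(LM lt F).
  rewrite /LC -(mcoeff_embed_x p) -LMF -Fp mcoeff_map_mpoly.
  rewrite -!raddf_sum -LTF /= /LT mcoeffZ mcoeffX eqxx mulr1 //.
rewrite {1}/LT LCp scaler_suml; apply: is_ideal_sum => // q /Gs[g [Gg _ ->]] _.
rewrite mcoeffM_LT; case: ifP => [leF|_]; last by rewrite raddf0 scale0r.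
rewrite rmorphM /=; have [->|hg] := eqVneq (h (LC lt g)) 0.
  by rewrite mulr0 scale0r.
(* [LM g] divides [LM F], whose y part is trivial. *)
have yg : ypart (LM lt g) = 0%MM.
  apply/eqP; have /(congr1 ypart) := LMF; rewrite ypartK -(submK leF) ypartD.
  by move=> /eqP; rewrite mnmD_eq0 => /andP[].
have LMg : LM lt g = mon_xy (xpart (LM lt g)) 0%MM by rewrite -yg mon_xyK.
(* All monomials of the image of [g] are at most [LM g], a monomial in the x variables, so the order
   forces them to be free of y. *)
have gE : embed_x m (retract_x (map_mpoly h g)) = map_mpoly h g.
  apply: retract_xK => u /(LM_ge lt_mo); rewrite LM_map //.
  by case/orP => [/eqP->//|]; rewrite LMg => /ypart_lt0.
set q' := retract_x _ in gE.
have q'0 : q' != 0.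
  apply: contraNneq hg => q'0; move/(congr1 (mcoeff (LM lt g))): gE.
  by rewrite mcoeff_map_mpoly q'0 /embed_x raddf0 mcoeff0 => <-.
have LMq' : LM (restrict_x lt) q' = xpart (LM lt g).
  by rewrite -(xpartK (LM (restrict_x lt) q') 0%MM) -LM_embed_x // gE LM_map.
have LCq' : LC (restrict_x lt) q' = h (LC lt g).
  by rewrite /LC LMq' -(mcoeff_embed_x q') -LMg gE mcoeff_map_mpoly.
(* The cofactor of [LT q'] is the monomial quotient of [LM F] by [LM g], read in the x variables. *)
set c := h _; have -> : (c * h (LC lt g)) *: 'X_[LM (restrict_x lt) p] =
    (c *: 'X_[xpart (LM lt F - LM lt g)%MM]) * LT (restrict_x lt) q'.
  rewrite /LT LMq' LCq' -scalerAr -scalerAl scalerA -mpolyXD mulrC.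
  congr (_ *: 'X_[_]); rewrite -(xpartK (LM (restrict_x lt) p) 0%MM) -LMF.
  by rewrite -xpartD submK.
apply: XM; apply: ideal_span_gen; exists q'; split=> //; last exact/eqP.
by exists g.
Qed.

End Elimination.

(** * The elimination theorem over the quotient ring *)

Theorem theorem2p6
  (L : comNzRingType) (L_noeth : noetherian L) (L_solver : linear_solver L)
  (s : nat) (nu : 'I_s -> L)
  (I : idealr L)
  (I_gen : forall a : L, a \in I <-> ideal_span (fun c => exists i, c = nu i) a)
  (n m t : nat)
  (fbar : 'I_t -> {mpoly {ideal_quot I}[n + m]})
  (fbar_neq0 : forall i, fbar i <> 0)
  (f : 'I_t -> {mpoly L[n + m]})
  (f_lift : forall (i : 'I_t) (u : 'X_{1..n + m}),
     ((fbar i)@_u = 0 -> (f i)@_u = 0) /\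
     ((fbar i)@_u <> 0 -> \pi_{ideal_quot I} (f i)@_u = (fbar i)@_u))
  (lt : rel 'X_{1..n + m}) (lt_elim : elimination_order lt)
  (G : {fset {mpoly L[n + m]}})
  (G_alg : gb_algorithm lt
     ([fset f i | i in 'I_t] `|` [fset (nu j)%:MP | j in 'I_s])%fset G) :
  let phi : {mpoly L[n + m]} -> {mpoly {ideal_quot I}[n + m]} :=
    map_mpoly \pi_{ideal_quot I} in
  let Gbar := ([fset phi g | g in G] `\ 0)%fset in
  let Jbar := ideal_span (fun p => exists i, p = fbar i) in
  is_groebner_basis (restrict_x lt)
    (fun p : {mpoly {ideal_quot I}[n]} => Jbar (embed_x m p))
    (fun p : {mpoly {ideal_quot I}[n]} => embed_x m p \in Gbar).
Proof.
have lt_mo : monomial_order lt by case: lt_elim.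
move=> phi Gbar Jbar; set S := (_ `|` _)%fset in G_alg.
have pi_surj (a : {ideal_quot I}) : exists b, \pi_{ideal_quot I} b = a.
  by exists (repr a); rewrite reprK.
have pi_eq0 a : (\pi_{ideal_quot I} a == 0) = (a \in I).
  by rewrite -[0](rmorph0 \pi_{ideal_quot I}) -Quotient.idealrBE subr0.
have phi_f i : phi (f i) = fbar i.
  apply/mpolyP => u; rewrite mcoeff_map_mpoly; have [f0 f1] := f_lift i u.
  by have [/[dup] /f0 -> ->|/eqP/f1//] := eqVneq (fbar i)@_u 0; rewrite raddf0.
have spanG := gb_algorithm_span G_alg.
have idJ := ideal_span_fset_ideal G; have [_ _ JM] := idJ.
have Sf i : ideal_span (fun g => g \in G) (f i).
  by apply/spanG/ideal_span_mem; rewrite inE; apply/orP; left; exact: in_imfset.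
(* The generators [nu j] of [I] belong to [S], so all constants from [I] lie in the ideal generated
   by [G]. *)
have kerJ a : \pi_{ideal_quot I} a = 0 -> ideal_span (fun g => g \in G) a%:MP.
  move/eqP; rewrite pi_eq0 => /I_gen[r nu_r ->].
  rewrite raddf_sum; apply: is_ideal_sum => // q /nu_r[j ->] _ /=.
  rewrite mpolyCM; apply: JM; apply/spanG/ideal_span_mem.
  by rewrite inE; apply/orP; right; exact: in_imfset.
have idJbar : is_ideal Jbar by exact: ideal_span_ideal.
(* The preimage of [Jbar] under [phi] is an ideal containing [S]: [f i] maps to [fbar i] and [nu j]
   to 0. *)
have GJbar g : g \in G -> Jbar (phi g).
  move=> /ideal_span_mem/spanG; move: g.
  have [J0 JD JbM] := idJbar.
  apply: ideal_span_least => [|g].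
    split=> [|a b Ja Jb|c a Ja]; first by rewrite /phi rmorph0.
      rewrite /phi rmorphD.
      exact: (JD _ _ Ja Jb).
    rewrite /phi rmorphM.
    exact: (JbM _ _ Ja).
  rewrite inE => /orP[] /imfsetP[i _ ->].
    by rewrite /= phi_f; apply: ideal_span_gen; exists i.
  have /eqP nu0 : \pi_{ideal_quot I} (nu i) == 0.
    by rewrite pi_eq0; apply/I_gen/ideal_span_gen; exists i.
  by rewrite /phi /= map_mpolyC /= nu0.
have GbarJ p : embed_x m p \in Gbar -> Jbar (embed_x m p) /\ p <> 0.
  case/fsetD1P=> p0 /imfsetP[g Gg gE]; split.
    by rewrite gE; exact: GJbar.
  by move/eqP: p0 => p0 pE; apply: p0; rewrite pE /embed_x raddf0.
split=> [|//|p].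
  (* The filter keeps exactly the elements of [Gbar] in the image of [embed_x], on which [retract_x]
     inverts the embedding. *)
  exists [seq retract_x g | g <- Gbar & embed_x m (retract_x g) == g] => p.
  split=> [Gp|/mapP[g]].
    by apply/mapP; exists (embed_x m p); rewrite ?mem_filter embed_xK ?eqxx.
  by rewrite mem_filter => /andP[/eqP gE Gg] ->; rewrite gE.
split; apply: ideal_span_least; try exact: ideal_span_ideal.
all: move=> {}p [q [Jq q0 ->]].
  have [F JF FE] : exists2 F, ideal_span (fun g => g \in G) F &
      phi F = embed_x m q.
    apply: ideal_span_lift Jq => // _ [i ->].
    by exists (f i).
  have phiF : phi F != 0.
    by apply/eqP; rewrite FE -(raddf0 (@embed_x _ n m)) => /embed_x_inj.
  (* The first lift may have a leading coefficient in [I]; it is replaced by one whose leading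
     coefficient survives modulo [I]. *)
  have [F' [JF' F'E hF']] := lift_LC lt_mo idJ kerJ JF phiF.
  have F'0 : F' <> 0 by move=> F'0; rewrite F'0 /LC mcoeff0 raddf0 eqxx in hF'.
  have LTF' := gb_algorithm_LT lt_mo G_alg JF' F'0.
  have := LT_elimination lt_elim LTF' hF' (etrans F'E FE).
  apply: ideal_span_least => [|_ [r [[g Gg gE] r0 ->]]].
    exact: ideal_span_ideal.
  apply: ideal_span_gen; exists r; split=> //.
  rewrite gE; apply/fsetD1P; split; last exact: in_imfset.
  apply/eqP; rewrite -gE.
  by rewrite -(raddf0 (@embed_x _ n m)) => /embed_x_inj.
(* The converse inclusion only needs that the elements of [Gbar] lie in [Jbar]. *)
by apply: ideal_span_gen; exists q; split=> //; case: (GbarJ _ Jq).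
Qed.
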